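(* Let $n\ge1$, $k\ge0$ be integers and $0\le\theta\le1$. For the separation and $\ell_\infty$ distances to uniform after $k$ $\theta$-biased riffle shuffles of $n$ cards, $$\mathrm{SEP}(k)=1-\sum_{w\in\mathfrak{S}_n}\mathrm{sgn}(w)\prod_{i=1}^n\left(\theta^i+(1-\theta)^i\right)^{k\,n_i(w)},$$ $$\ell_\infty(k)=\sum_{w\in\mathfrak{S}_n}\prod_{i=1}^n\left(\theta^i+(1-\theta)^i\right)^{k\,n_i(w)}-1,$$ where $n_i(w)$ is the number of $i$-cycles in the permutation $w$.
   Context: The $\theta$-biased riffle shuffle measure $P_\theta$ on the symmetric group $\mathfrak{S}_n$: start with a deck of $n$ cards in the order $1,2,\ldots,n$ from top to bottom. Cut off the top $N$ cards as the left pile, where $N$ has the binomial$(n,\theta)$ distribution, the remaining $n-N$ cards forming the right pile. Then drop cards one at a time from the bottoms of the piles: if the left pile currently has $A$ cards and the right pile $B$ cards, the next card is dropped from the bottom of the left pile with probability $A/(A+B)$ and otherwise from the bottom of the right pile; continue until all cards are dropped into a single pile. $P_\theta(w)$ is the probability that the resulting deck, read from top to bottom, is $w=w(1)w(2)\cdots w(n)$. Convolution powers: $P_\theta^{*0}$ is the point mass at the identity and $P_\theta^{*k}(w)=\sum_{v\in\mathfrak{S}_n}P_\theta(v)P_\theta^{*(k-1)}(v^{-1}w)$ for $k\ge1$. The uniform distribution is $U(w)=1/n!$. Distances: $\mathrm{SEP}(k)=\max_{w\in\mathfrak{S}_n}\left(1-\frac{P_\theta^{*k}(w)}{U(w)}\right)$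 and $\ell_\infty(k)=\max_{w\in\mathfrak{S}_n}\left|1-\frac{P_\theta^{*k}(w)}{U(w)}\right|$. *)

(* Defs.v *)
From HB Require Import structures.
From mathcomp Require Import all_boot all_order all_fingroup all_algebra.

Set Implicit Arguments.
Unset Strict Implicit.
Unset Printing Implicit Defensive.

Import Order.TTheory GRing.Theory Num.Theory.

Local Open Scope ring_scope.

(* Decks and piles are sequences read from top to bottom, and the bottom card
   is cut off as a sequence of size 1 (or 0 when the pile is empty).          *)
Definition bottom_card (T : Type) (s : seq T) : seq T := drop (size s).-1 s.
Definition above_bottom (T : Type) (s : seq T) : seq T := take (size s).-1 s.

(* drop_pr m l r d w is the probability that, starting from the left pile l,
   the right pile r and the pile d of the cards already dropped, the deck
   obtained after m further drops is w.  Each card lands on top of d.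
   The drop from an empty pile has weight 0 as long as cards remain.          *)
Fixpoint drop_pr (R : realFieldType) (T : eqType) (m : nat)
    (l r d w : seq T) : R :=
  if m is m'.+1 then
    let p := (size l)%:R / (size l + size r)%:R in
    p * drop_pr R m' (above_bottom l) r (bottom_card l ++ d) w
    + (1 - p) * drop_pr R m' l (above_bottom r) (bottom_card r ++ d) w
  else (d == w)%:R.

(* The deck w(1) w(2) ... w(n), with cards and positions indexed by 'I_n.     *)
Definition deck (n : nat) (w : 'S_n) : seq 'I_n := [seq w i | i <- enum 'I_n].

Definition riffle (R : realFieldType) (n : nat) (theta : R) (w : 'S_n) : R :=
  \sum_(N < n.+1)
    'C(n, N)%:R * theta ^+ N * (1 - theta) ^+ (n - N) *
    drop_pr R n (take N (enum 'I_n)) (drop N (enum 'I_n)) [::] (deck w).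

(* The product of 'S_n composes from left to right, so w * v^-1 is the function
   i |-> v^-1 (w i), i.e. v^-1 w for the usual composition of functions.      *)
Fixpoint conv_pow (R : realFieldType) (n : nat) (P : 'S_n -> R) (k : nat)
    (w : 'S_n) : R :=
  if k is k'.+1 then \sum_(v : 'S_n) P v * conv_pow P k' (w * v^-1)%g
  else (w == 1%g)%:R.

Definition unif (R : realFieldType) (n : nat) (w : 'S_n) : R := 1 / (n`!)%:R.

(* Seeding the iterated maximum with a value of f makes it the maximum of f.  *)
Definition max_perm (R : realFieldType) (n : nat) (f : 'S_n -> R) : R :=
  \big[Num.max/f 1%g]_(w : 'S_n) f w.

Definition SEP (R : realFieldType) (n : nat) (theta : R) (k : nat) : R :=
  max_perm (fun w : 'S_n => 1 - conv_pow (riffle theta) k w / unif R w).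

Definition linf (R : realFieldType) (n : nat) (theta : R) (k : nat) : R :=
  max_perm (fun w : 'S_n => `|1 - conv_pow (riffle theta) k w / unif R w|).

(* Fixed points are the 1-cycles. *)
Definition ncycles (n : nat) (i : nat) (w : 'S_n) : nat :=
  #|[set C in porbits w | #|C| == i]|.

Definition sgn (R : realFieldType) (n : nat) (w : 'S_n) : R :=
  (-1) ^+ odd_perm w.

(* Main.v *)
Require Import Defs.
From HB Require Import structures.
From mathcomp Require Import all_boot all_order all_fingroup all_algebra.

Set Implicit Arguments.
Unset Strict Implicit.
Unset Printing Implicit Defensive.

Import Order.TTheory GRing.Theory Num.Theory.

Local Open Scope ring_scope.

(** Riffle shuffles are sorting backwards.  Give each position of the deck a
    letter of a finite ordered alphabet, letter a with weight q a, and sort the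
    positions stably by their letters; the permutation obtained from a word f is
    its standardization [std f].  With the alphabet {left, right} of weights
    theta, 1 - theta, the total weight of the words standardizing to w is the
    riffle probability of w ([riffle_word_law]): the letters say which pile each
    card of the final deck came from, and given the cut, all interleavings are
    equally likely ([drop_prE]).

    Sorting twice is sorting once by pairs of letters, so the convolution of two
    such laws is the law of the lexicographic product alphabet
    ([word_law_conv]).  Hence k shuffles are one sort over an alphabet whose
    power sums p_i = sum of the q a ^ i are (theta^i + (1 - theta)^i)^k
    ([conv_pow_word_law]).

    Reading a word with standardization w in sorted order gives a weakly
    increasing word of the same weight, and every strictly increasing word so
    arises.  The probability of w thus lies between the sum E of the weights of
    the strictly increasing words (the elementary symmetric function e_n of the
    q a) and the sum H for the weakly increasing ones (the complete symmetric
    function h_n).  The identity attains H and the reversal attains E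
    ([word_law_le], [word_law_ge], [word_law1], [word_law_rev]).

    The expansions n! h_n = sum_w p_cyc(w) and n! e_n = sum_w sgn(w) p_cyc(w)
    come from double counting pairs (word, permutation stabilizing it)
    ([fact_nondecr_sum], [fact_incr_sum]).  This settles the separation
    distance.  For the l-infinity distance, the deviation n! H - 1 at the
    identity must beat 1 - n! E at the reversal: adding the two expansions, the
    odd permutations cancel, the others contribute nonnegatively, and the
    identity alone contributes 2 ([nondecr_incr_sum_ge2]). *)

(** * Standardization of words *)

Section Standardization.

Variables (d : Order.disp_t) (A : finOrderType d) (n : nat).
Implicit Types (f g : {ffun 'I_n -> A}) (u v w : 'S_n) (i j : 'I_n).

(** The order in which a stable sort by letter reads the positions. *)
Definition before f i j : bool :=
  ((f i < f j)%O || (f i == f j) && (i < j)%N).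

Lemma before_irr f : irreflexive (before f).
Proof. by move=> i; rewrite /before ltxx ltnn andbF. Qed.

Lemma before_trans f : transitive (before f).
Proof.
move=> j i k; rewrite /before => /orP[lt_ij | /andP[/eqP-> lt_ij]].
  by case/orP=> [/(lt_trans lt_ij)-> // | /andP[/eqP<- _]]; rewrite lt_ij.
by case/orP=> [-> // | /andP[-> /(ltn_trans lt_ij)->]]; apply: orbT.
Qed.

Lemma before_total f i j : i != j -> ~~ before f i j -> before f j i.
Proof.
rewrite /before; case: ltgtP => //= _.
by rewrite neq_ltn => /orP[->|->].
Qed.

Definition rank f i : nat := #|[set j | before f j i]|.

Lemma rank_lt f i : (rank f i < n)%N.
Proof.
suffices: (rank f i < #|[set: 'I_n]|)%N by rewrite cardsT card_ord.
apply: proper_card.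
rewrite properE subsetT /=; apply/subsetPn; exists i; first by rewrite inE.
by rewrite inE before_irr.
Qed.

Lemma rank_mono f i j : before f i j -> (rank f i < rank f j)%N.
Proof.
move=> f_ij; apply: proper_card; rewrite properE; apply/andP; split.
  by apply/subsetP=> k; rewrite !inE => /before_trans; apply.
by apply/subsetPn; exists i; rewrite !inE // before_irr.
Qed.

Lemma rank_inj f : injective (fun i => Ordinal (rank_lt f i)).
Proof.
move=> i j [eq_rk]; apply: contraTeq isT => ne_ij.
have [/rank_mono | /before_total-/(_ ne_ij)/rank_mono] := boolP (before f i j);
  by rewrite eq_rk ltnn.
Qed.

Definition std f : 'S_n := perm (@rank_inj f).

Lemma stdE f i j : (std f i < std f j)%N = before f i j.
Proof.
rewrite !permE /=; apply/idP/idP; last exact: rank_mono.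
apply: contraTT => f'ij; rewrite -leqNgt.
have [-> // | ne_ij] := eqVneq i j.
by rewrite ltnW // rank_mono // before_total.
Qed.

Lemma perm_rank w i : #|[set j | (w j < w i)%N]| = w i.
Proof.
rewrite -(card_imset _ (@perm_inj _ w)).
have ->: w @: [set j | (w j < w i)%N] = [set j : 'I_n | (j < w i)%N].
    apply/setP=> j; rewrite inE; apply/imsetP/idP => [[k] | lt_j].
    by rewrite inE => lt_k ->.
  by exists (w^-1%g j); rewrite ?inE permKV.
rewrite -sum1dep_card (big_ord_narrow (ltnW (ltn_ord (w i)))).
by rewrite sum1_card card_ord.
Qed.

(** [std f] is the only permutation that ranks the positions as [before f] does,
    so a standardization can be recognized without computing ranks. *)
Lemma std_unique f w :
  (forall i j, (w i < w j)%N = before f i j) -> std f = w.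
Proof.
move=> wE; apply/permP=> i; apply/val_inj; rewrite permE /= -perm_rank.
by apply: eq_card => j; rewrite !inE wE.
Qed.

(** As products in 'S_n compose from left to right, u acts after v in u * v:
    see [wcompM]. *)
Definition wcomp f u : {ffun 'I_n -> A} := [ffun i => f (u i)].

Lemma wcompM f u v : wcomp f (u * v)%g = wcomp (wcomp f v) u.
Proof. by apply/ffunP=> i; rewrite !ffunE permM. Qed.

Lemma wcomp1 f : wcomp f 1%g = f.
Proof. by apply/ffunP=> i; rewrite ffunE perm1. Qed.

Lemma wcompK u : cancel (wcomp^~ u) (wcomp^~ u^-1%g).
Proof. by move=> f; rewrite /= -wcompM mulVg wcomp1. Qed.

Definition nondecr f :=
  [forall i : 'I_n, forall j : 'I_n, (i <= j)%N ==> (f i <= f j)%O].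
Definition incr f :=
  [forall i : 'I_n, forall j : 'I_n, (i < j)%N ==> (f i < f j)%O].

Lemma nondecrP f :
  reflect (forall i j, (i <= j)%N -> (f i <= f j)%O) (nondecr f).
Proof.
apply: (iffP forallP) => [f_le i j | f_le i].
  by move/forallP/(_ j)/implyP: (f_le i); apply.
by apply/forallP=> j; apply/implyP; apply: f_le.
Qed.

Lemma incrP f :
  reflect (forall i j, (i < j)%N -> (f i < f j)%O) (incr f).
Proof.
apply: (iffP forallP) => [f_le i j | f_le i].
  by move/forallP/(_ j)/implyP: (f_le i); apply.
by apply/forallP=> j; apply/implyP; apply: f_le.
Qed.

(** Position w^-1 i is the i-th one in the sorted order, so f read along w^-1 is
    f sorted. *)
Lemma std_nondecr f w : std f = w -> nondecr (wcomp f w^-1%g).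
Proof.
move=> <-; apply/nondecrP=> i j le_ij; rewrite !ffunE leNgt.
apply: contraL le_ij => lt_ji; rewrite -ltnNge.
by rewrite -[i](permKV (std f)) -[j](permKV (std f)) stdE /before lt_ji.
Qed.

(** With distinct letters no ties need breaking, so any sorting permutation is
    the standardization; ties are why [std_nondecr] has no full converse. *)
Lemma incr_std f w : incr (wcomp f w^-1%g) -> std f = w.
Proof.
move=> /incrP f_lt.
have{}f_lt i j : (w i < w j)%N -> (f i < f j)%O.
  by move=> /f_lt; rewrite !ffunE !permK.
apply: std_unique => i j; rewrite /before.
have [/f_lt-> // | /f_lt | /val_inj/perm_inj->] := ltngtP (w i) (w j).
  by case: ltgtP.
by rewrite ltxx ltnn andbF.
Qed.

Lemma std1E f : (std f == 1%g) = nondecr f.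
Proof.
apply/eqP/idP=> [/std_nondecr | /nondecrP f_le]; first by rewrite invg1 wcomp1.
apply: std_unique => i j; rewrite !perm1 /before.
have [lt_ij | le_ji] := ltnP i j.
  by have:= f_le i j (ltnW lt_ij); case: ltgtP.
by have:= f_le j i le_ji; rewrite andbF orbF; case: ltgtP.
Qed.

Definition rev_perm : 'S_n := perm (@rev_ord_inj n).

(** The reversal allows no tie: a stable sort would keep equal letters in their
    order of position. *)
Lemma std_revE f : (std f == rev_perm) = incr (wcomp f rev_perm^-1%g).
Proof.
apply/eqP/idP=> [def_f | /incr_std //]; apply/incrP=> i j lt_ij.
rewrite !ffunE; set i' := _ i; set j' := _ j.
have rv k : rev_perm k = (n - k.+1)%N :> nat by rewrite permE.
have: before f i' j' by rewrite -stdE def_f !permKV.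
rewrite /before; case/orP=> // /andP[_ lt_ij'].
have:= lt_ij; rewrite -[i](permKV rev_perm) -[j](permKV rev_perm) -/i' -/j'.
by rewrite !rv ltnNge leq_sub2l // ltnS ltnW.
Qed.

(** A sorted sequence is determined by its multiset of letters. *)
Lemma nondecr_wcomp f u : nondecr f -> nondecr (wcomp f u) -> wcomp f u = f.
Proof.
have sorted_nd g : nondecr g -> sorted <=%O (map g (enum 'I_n)).
  move=> /nondecrP g_le; rewrite sorted_map.
  apply: (@sub_sorted _ (relpre val leq)) => [i j /= /g_le //|].
  rewrite -sorted_map val_enum_ord; exact: iota_sorted.
move=> /sorted_nd f_s /sorted_nd fu_s.
suffices eq_m: map (wcomp f u) (enum 'I_n) = map f (enum 'I_n).
  by apply/ffunP=> i; move/eq_in_map: eq_m; apply; rewrite mem_enum.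
apply: (sorted_eq le_trans le_anti fu_s f_s).
rewrite (@eq_map _ _ _ (f \o u)); last by move=> i; rewrite ffunE.
rewrite map_comp; apply/perm_map/uniq_perm; rewrite ?enum_uniq //.
  by rewrite map_inj_uniq ?enum_uniq //; apply: perm_inj.
move=> i; rewrite mem_enum inE; apply/mapP; exists (u^-1 i)%g.
  by rewrite mem_enum.
by rewrite permKV.
Qed.

(** The permutations that sort f form a coset of its stabilizer, with
    representative (std f)^-1. *)
Lemma card_nondecr f :
  #|[set u | nondecr (wcomp f u)]| = #|[set u | wcomp f u == f]|.
Proof.
set s := ((std f)^-1)%g; have nd_s : nondecr (wcomp f s) by apply: std_nondecr.
have mem_u u : nondecr (wcomp f u) = (wcomp f (s^-1 * u)%g == f).
  apply/idP/eqP=> [nd_u | fu]; last first.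
    by rewrite -[u](mulKVg s) wcompM fu.
  rewrite wcompM; apply: (canLR (wcompK s)).
  rewrite -[in LHS](mulgKV s u) wcompM; apply: nondecr_wcomp => //.
  by rewrite -wcompM mulgKV.
rewrite -[RHS](card_imset _ (mulgI s)); apply: eq_card => u.
rewrite inE mem_u; apply/eqP/imsetP => [fu | [v]].
  by exists (s^-1 * u)%g; rewrite ?inE ?fu // mulKVg.
by rewrite inE => /eqP fv ->; rewrite mulKg.
Qed.
End Standardization.

(** * Weights of words and extreme values of their law *)

Section Weights.

Variables (R : realFieldType) (d : Order.disp_t) (A : finOrderType d) (n : nat).
Variable q : A -> R.
Implicit Types (f g : {ffun 'I_n -> A}) (u v w : 'S_n) (i j : 'I_n).

Definition weight f : R := \prod_i q (f i).
(** The law of the standardization of a random word, whose letters are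
    independent of law q when q sums to 1. *)
Definition word_law w : R := \sum_(f | std f == w) weight f.
Definition nondecr_sum : R := \sum_(f | nondecr f) weight f.
Definition incr_sum : R := \sum_(f | incr f) weight f.
Definition power_sum (m : nat) : R := \sum_a q a ^+ m.
Definition cycle_weight w : R :=
  \prod_(1 <= m < n.+1) power_sum m ^+ ncycles m w.

Lemma weight_wcomp f u : weight (wcomp f u) = weight f.
Proof.
rewrite /weight [RHS](reindex_inj (@perm_inj _ u)).
by apply: eq_bigr => i _; rewrite ffunE.
Qed.

(** The weight of a word does not depend on the order of its letters. *)
Lemma sum_wcomp (P : pred {ffun 'I_n -> A}) u :
  \sum_(f | P f) weight f = \sum_(f | P (wcomp f u)) weight f.
Proof.
rewrite (reindex_inj (can_inj (@wcompK _ A n u))).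
by apply: eq_bigr => f _; rewrite weight_wcomp.
Qed.

Lemma word_law1 : word_law 1%g = nondecr_sum.
Proof. by apply: eq_bigl => f; rewrite std1E. Qed.

Lemma word_law_rev : word_law (rev_perm n) = incr_sum.
Proof.
rewrite /incr_sum (sum_wcomp _ (rev_perm n)^-1%g).
by apply: eq_bigl => f; rewrite std_revE.
Qed.

Section Bounds.
Hypothesis q_ge0 : forall a, 0 <= q a.

Lemma weight_ge0 f : 0 <= weight f.
Proof. exact: prodr_ge0. Qed.

Lemma ler_sum_weight (P Q : pred {ffun 'I_n -> A}) :
  subpred P Q -> \sum_(f | P f) weight f <= \sum_(f | Q f) weight f.
Proof.
move=> sPQ; rewrite (bigID P Q) /=.
rewrite (eq_bigl P) => [|f]; last first.
  by case: (boolP (P f)) => [/sPQ->|]; rewrite ?andbF.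
by rewrite lerDl sumr_ge0 // => f _; apply: weight_ge0.
Qed.

Lemma word_law_le w : word_law w <= nondecr_sum.
Proof.
rewrite /nondecr_sum (sum_wcomp _ w^-1%g).
by apply: ler_sum_weight => f /eqP/std_nondecr.
Qed.

Lemma word_law_ge w : incr_sum <= word_law w.
Proof.
rewrite /incr_sum (sum_wcomp _ w^-1%g).
by apply: ler_sum_weight => f /incr_std/eqP.
Qed.

End Bounds.

(** * Expansions over permutations by cycle type *)

(** The words fixed by w are those constant on its cycles; choosing one letter
    for each cycle C contributes the factor p_|C|. *)
Lemma sum_fixed w : \sum_(f | wcomp f w == f) weight f = cycle_weight w.
Proof.
(* Words fixed by w correspond to functions on I, the type of cycles of w. *)
pose I := {C : {set 'I_n} | C \in porbits w}.
have clP i : porbit w i \in porbits w by apply/imsetP; exists i.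
pose cl i : I := exist _ (porbit w i) (clP i).
have cl_repr (C : I) : exists i, cl i == C.
  by have /imsetP[i _ CE] := valP C; exists i; apply/eqP/val_inj.
pose rep (C : I) := xchoose (cl_repr C).
have repK C : cl (rep C) = C by apply/eqP/(xchooseP (cl_repr C)).
have clw i : cl (w i) = cl i.
  apply/val_inj/eqP; rewrite /= eq_porbit_mem.
  by rewrite -[w i]/(aperm i w) -{1}(expg1 w) mem_porbit.
have fixE f i : wcomp f w = f -> f (rep (cl i)) = f i.
  move=> fw; have /(congr1 val)/eqP := repK (cl i).
  rewrite /= eq_porbit_mem => /porbitP[m ->].
  elim: m => [|m IHm]; first by rewrite expg0 perm1.
  by rewrite expgSr permM -[in RHS]IHm -[in RHS]fw ffunE.
(* The middle term has one power sum per cycle; the product over cycle lengths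
   regroups it. *)
transitivity (\prod_(C : I) power_sum #|val C|); last first.
  rewrite (partition_big (fun C : I => inord #|val C| : 'I_n.+1) predT) //=.
  have sizeP (C : I) : (0 < #|val C| < n.+1)%N.
    have -> : (#|val C| < n.+1)%N.
      by rewrite ltnS -[n in leqRHS]card_ord max_card.
    rewrite andbT.
    have /imsetP[i _ ->] := valP C.
    by apply/card_gt0P; exists i; apply: porbit_id.
  (* No cycle has length 0, so the factor of index 0 is an empty product. *)
  rewrite big_ord_recl big1 => [|C]; last first.
    by case/andP: (sizeP C) => C0 Cn; rewrite -val_eqE /= inordK // eqn0Ngt C0.
  rewrite mul1r /cycle_weight big_add1 /= big_mkord; apply: eq_bigr => i _.
  have memP (C : I) : (inord #|val C| == lift ord0 i) = (#|val C| == i.+1).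
    by case/andP: (sizeP C) => C0 Cn; rewrite -val_eqE /= inordK.
  rewrite (eq_bigr (fun=> power_sum i.+1)) => [|C]; last first.
    by rewrite memP => /eqP->.
  rewrite prodr_const; congr (_ ^+ _).
  rewrite /ncycles -(card_imset _ val_inj); apply: eq_card => C.
  rewrite !inE; apply/imsetP/andP => [[D D_i ->] | [wC sC]].
    by split; [apply: (valP D) | rewrite -memP; apply: D_i].
  exists (exist _ C wC) => //.
  by have D_i := memP (exist _ C wC); rewrite sC in D_i; apply: D_i.
rewrite bigA_distr_bigA /=.
pose h (g : {ffun I -> A}) := [ffun i => g (cl i)].
pose h' f := [ffun C => f (rep C)].
rewrite (reindex_onto h h') => [|f /eqP fw]; last first.
  by apply/ffunP=> i; rewrite !ffunE fixE.
apply: eq_big => [g | g _].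
  apply/andP; split; last by apply/eqP/ffunP=> C; rewrite !ffunE repK.
  by apply/eqP/ffunP=> i; rewrite !ffunE clw.
rewrite /weight (partition_big cl predT) //=; apply: eq_bigr => C _.
rewrite (eq_bigr (fun=> q (g C))) => [|i /eqP <-]; last by rewrite ffunE.
rewrite prodr_const; congr (_ ^+ _); apply: eq_card => i.
transitivity (cl i == C); first by [].
rewrite -val_eqE /=; have /imsetP[j _ ->] := valP C.
by rewrite eq_porbit_mem.
Qed.

(** Both sides count pairs (f, u): on the left u sorts f, on the right u fixes
    f, and for each f there are equally many of either kind by
    [card_nondecr]. *)
Lemma fact_nondecr_sum :
  n`!%:R * nondecr_sum = \sum_w cycle_weight w.
Proof.
transitivity (\sum_u \sum_(f | nondecr (wcomp f u)) weight f).
  rewrite (eq_bigr (fun=> nondecr_sum)) => [|u _]; last by rewrite -sum_wcomp.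
  by rewrite sumr_const card_Sn mulr_natl.
rewrite (eq_bigr _ (fun w _ => esym (sum_fixed w))).
rewrite (exchange_big_dep predT) //= [RHS](exchange_big_dep predT) //=.
apply: eq_bigr => f _; rewrite !sumr_const; congr (_ *+ _).
by have := card_nondecr f; rewrite !cardsE.
Qed.

Lemma stab_inj f u : injective f -> wcomp f u = f -> u = 1%g.
Proof.
move=> f_inj fu; apply/permP=> i; rewrite perm1; apply: f_inj.
by rewrite -[in RHS]fu ffunE.
Qed.

Lemma incr_injE f u : incr (wcomp f u) = nondecr (wcomp f u) && injectiveb f.
Proof.
apply/idP/andP=> [/incrP f_lt | [/nondecrP f_le /injectiveP f_inj]].
  split.
    apply/nondecrP=> i j; rewrite leq_eqVlt => /orP[/eqP/val_inj-> // | ?].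
    exact/ltW/f_lt.
  apply/injectiveP=> i j eq_f.
  apply/(@perm_inj _ u^-1)/val_inj.
  have f_inv k : wcomp f u (u^-1%g k) = f k by rewrite ffunE permKV.
  case: (ltngtP (u^-1 i) (u^-1 j))%g => // /f_lt;
    by rewrite !f_inv eq_f ltxx.
apply/incrP=> i j lt_ij; rewrite lt_neqAle f_le ?(ltnW lt_ij) // andbT !ffunE.
by rewrite (inj_eq f_inj) (inj_eq perm_inj) -val_eqE /= ltn_eqF.
Qed.

(** Two equal letters give a transposition in the stabilizer, multiplication by
    which cancels the signs; distinct letters have a trivial stabilizer. *)
Lemma sum_sgn_stab f :
  \sum_(u | wcomp f u == f) sgn R u =
  if injectiveb f then #|[set u | wcomp f u == f]|%:R else 0.
Proof.
case: injectiveP => [f_inj | f_ninj].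
  rewrite cardsE -sum1_card natr_sum; apply: eq_bigr => u.
  by move=> /eqP/(stab_inj f_inj)->; rewrite /sgn odd_perm1.
have /injectivePn[i [j ne_ij eq_f]] : ~~ injectiveb f by apply/injectiveP.
have f_ij : wcomp f (tperm i j) = f.
  by apply/ffunP=> k; rewrite ffunE; case: tpermP => // ->.
apply/eqP; rewrite -eqNr; apply/eqP.
rewrite [RHS](reindex_inj (mulIg (tperm i j))) /= -sumrN.
apply: eq_big => u; first by rewrite wcompM f_ij.
by move=> _; rewrite /sgn odd_permM odd_tperm ne_ij signr_addb mulrN1.
Qed.

(** As for [fact_nondecr_sum], with the signs removing from the right side the
    words with a repeated letter, which no permutation sorts strictly. *)
Lemma fact_incr_sum :
  n`!%:R * incr_sum = \sum_w sgn R w * cycle_weight w.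
Proof.
transitivity (\sum_u \sum_(f | incr (wcomp f u)) weight f).
  rewrite (eq_bigr (fun=> incr_sum)) => [|u _]; last by rewrite -sum_wcomp.
  by rewrite sumr_const card_Sn mulr_natl.
under [RHS]eq_bigr => w _ do rewrite -sum_fixed mulr_sumr.
rewrite (exchange_big_dep predT) //= [RHS](exchange_big_dep predT) //=.
apply: eq_bigr => f _; rewrite -mulr_suml sum_sgn_stab.
under eq_bigl => u do rewrite incr_injE.
rewrite sumr_const; case: ifP => _; last first.
  rewrite mul0r (eq_card0 (A := fun u => _)) // => u.
  by rewrite unfold_in andbF.
rewrite mulr_natl -card_nondecr cardsE; congr (_ *+ _).
by apply: eq_card => u; rewrite !unfold_in andbT.
Qed.

End Weights.

(** * Convolution is a lexicographic product of alphabets *)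

Section Convolution.

Variables (R : realFieldType) (d1 d2 : Order.disp_t).
Variables (A : finOrderType d1) (B : finOrderType d2) (n : nat).
Variables (qA : A -> R) (qB : B -> R).

Definition lexi_weight (x : A *l B) : R := qA x.1 * qB x.2.

(** The word g is sorted first; then the letters of f are attached to the
    positions of the sorted deck, that is, to std g i for the position i. *)
Definition lexi_word (f : {ffun 'I_n -> A}) (g : {ffun 'I_n -> B}) :
  {ffun 'I_n -> A *l B} := [ffun i => (f (std g i), g i)].

Lemma std_lexi_word f g : std (lexi_word f g) = (std g * std f)%g.
Proof.
apply: std_unique => i j; rewrite !permM stdE /before !ffunE stdE /before.
rewrite ltxi_pair xpair_eqE.
by case: (ltgtP (f _) (f _)).
Qed.

Lemma weight_lexi_word f g :
  weight lexi_weight (lexi_word f g) = weight qA f * weight qB g.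
Proof.
rewrite -(weight_wcomp qA f (std g)) -big_split; apply: eq_bigr => i _.
by rewrite !ffunE.
Qed.

Lemma word_law_conv (w : 'S_n) :
  \sum_v word_law qA v * word_law qB (w * v^-1)%g = word_law lexi_weight w.
Proof.
transitivity (\sum_(f : {ffun 'I_n -> A})
                weight qA f * word_law qB (w * (std f)^-1)%g).
  rewrite (partition_big (@std _ A n) predT) //=; apply: eq_bigr => v _.
  by rewrite mulr_suml; apply: eq_bigr => f /eqP->.
under eq_bigr => f _ do rewrite mulr_sumr.
rewrite pair_big_dep /=.
pose fst_word (h : {ffun 'I_n -> A *l B}) : {ffun 'I_n -> A} :=
  [ffun i => (h i).1].
pose snd_word (h : {ffun 'I_n -> A *l B}) : {ffun 'I_n -> B} :=
  [ffun i => (h i).2].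
pose split_word h := (wcomp (fst_word h) (std (snd_word h))^-1%g, snd_word h).
have split_wordK : cancel split_word (fun p => lexi_word p.1 p.2).
  by move=> h; apply/ffunP=> i; rewrite !ffunE permK -surjective_pairing.
have lexi_wordK : cancel (fun p => lexi_word p.1 p.2) split_word.
  move=> [f g]; have sndE : snd_word (lexi_word f g) = g.
    by apply/ffunP=> i; rewrite !ffunE.
  rewrite /split_word sndE; congr (_, _); apply/ffunP=> i.
  by rewrite !ffunE permKV.
rewrite [RHS](reindex_onto (fun p => lexi_word p.1 p.2) split_word) /=;
  last first.
  by move=> h _; apply: split_wordK.
apply: eq_big => [] [f g] /=; last by rewrite weight_lexi_word.
rewrite (lexi_wordK (f, g)) eqxx andbT std_lexi_word.
by rewrite (can2_eq (mulgK _) (mulgKV _)).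
Qed.

Lemma power_sum_lexi m :
  power_sum lexi_weight m = power_sum qA m * power_sum qB m.
Proof.
rewrite /power_sum mulr_suml.
under [RHS]eq_bigr => a _ do rewrite mulr_sumr.
by rewrite pair_big; apply: eq_bigr => [] [a b] _; rewrite -exprMn.
Qed.

End Convolution.

(** The alphabet grows with k; only its power sums matter, and they multiply.
    The trivial shuffle has a single letter of weight 1, as all words of equal
    letters are already sorted. *)
Lemma conv_pow_word_law (R : realFieldType) (n k : nat)
    d (A : finOrderType d) (q : A -> R) (P : 'S_n -> R) :
  (forall a, 0 <= q a) -> P =1 word_law q ->
  exists d' (B : finOrderType d') (r : B -> R),
    [/\ forall b, 0 <= r b,
        forall m, power_sum r m = power_sum q m ^+ k
      & conv_pow P k =1 word_law r].
Proof.
move=> q_ge0 PE; elim: k => [|k [d' [B [r [r_ge0 r_psum r_law]]]]].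
  exists _, 'I_1, (fun=> 1); split=> [//|m|w].
    by rewrite /power_sum big_const card_ord /= addr0 expr1n.
  have std_const (f : {ffun 'I_n -> 'I_1}) : std f = 1%g.
    by apply/eqP; rewrite std1E; apply/nondecrP => i j _; rewrite !ord1.
  rewrite /= /word_law (eq_bigr (fun=> 1)) => [|f _]; last first.
    by rewrite /weight big1.
  under eq_bigl => f do rewrite std_const eq_sym.
  case: (w == 1%g); last by rewrite big_pred0_eq.
  by rewrite sumr_const card_ffun card_ord exp1n.
exists _, (A *l B)%type, (lexi_weight q r); split=> [x|m|w].
- exact: mulr_ge0.
- by rewrite power_sum_lexi r_psum exprS.
by rewrite -word_law_conv /=; apply: eq_bigr => v _; rewrite PE r_law.
Qed.

(** * A riffle shuffle is a sort over two letters *)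

Section Riffle.

Variable R : realFieldType.

(** Given the cut, all interleavings of the two piles are equally likely.  The
    predicate c tells the cards of the left pile from those of the right one, so
    w is an interleaving of l and r on top of s exactly when its first m cards,
    filtered by c and by its negation, give back l and r. *)
Lemma drop_prE (T : eqType) (c : pred T) m (l r s w : seq T) :
    all c l -> all (predC c) r ->
    (size l + size r)%N = m -> size w = (m + size s)%N ->
  'C(m, size l)%:R * drop_pr R m l r s w =
  [&& drop m w == s, filter c (take m w) == l
    & filter (predC c) (take m w) == r]%:R.
Proof.
elim: m l r s w => [|m IHm] l r s w cl cr sz_lr sz_w.
  move/eqP: sz_lr; rewrite addn_eq0 !size_eq0 => /andP[/eqP-> /eqP->].
  by rewrite bin0 mul1r drop0 take0 /= andbT eq_sym.
have lt_mw : (m < size w)%N by rewrite sz_w addSn ltnS leq_addr.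
have [u [z [e [sz_u def_w]]]] :
    exists u, exists z, exists e, size u = m /\ w = u ++ z :: e.
  have [x0 _] : exists x0 : T, true by case: (w) lt_mw => // x0; exists x0.
  exists (take m w), (nth x0 w m), (drop m.+1 w).
  by rewrite size_takel 1?ltnW // -drop_nth // cat_take_drop.
have dropS : drop m.+1 w = e.
  by rewrite def_w -cat_rcons drop_size_cat // size_rcons sz_u.
have takeS : take m.+1 w = rcons u z.
  by rewrite def_w -cat_rcons take_size_cat // size_rcons sz_u.
have dropm : drop m w = z :: e by rewrite def_w drop_size_cat.
have takem : take m w = u by rewrite def_w take_size_cat.
(* The bottom card z of the interleaving decides which pile was dropped from:
   only the term of that pile survives. *)
have m1_neq0 : m.+1%:R != 0 :> R by rewrite pnatr_eq0.
rewrite dropS takeS !filter_rcons /= sz_lr mulrDr.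
set rhs := [&& _, _ & _].
suffices [-> ->] :
    ('C(m.+1, size l)%:R * ((size l)%:R / m.+1%:R *
       drop_pr R m (above_bottom l) r (bottom_card l ++ s) w) =
     (c z && rhs)%:R) /\
    ('C(m.+1, size l)%:R * ((1 - (size l)%:R / m.+1%:R) *
       drop_pr R m l (above_bottom r) (bottom_card r ++ s) w) =
     (~~ c z && rhs)%:R).
  by case: (c z); rewrite /= ?addr0 ?add0r.
rewrite /rhs; split.
  case/lastP: l cl sz_lr {rhs} => [_ _ | l x].
    rewrite mul0r mul0r mulr0; case: (c z) => //=.
    by rewrite -size_eq0 size_rcons /= andbF.
  rewrite all_rcons => /andP[cx cl]; rewrite size_rcons addSn => -[sz_lr].
  rewrite /above_bottom /bottom_card size_rcons /= -cats1.
  rewrite take_size_cat // drop_size_cat // cats1.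
  have -> : 'C(m.+1, (size l).+1)%:R * ((size l).+1%:R / m.+1%:R *
      drop_pr R m l r (x :: s) w) =
      'C(m, size l)%:R * drop_pr R m l r (x :: s) w.
    rewrite !mulrA -natrM mulnC -mul_bin_diag natrM.
    by rewrite [_ * 'C(_, _)%:R]mulrC mulfK.
  rewrite IHm //; last by rewrite sz_w addSnnS.
  rewrite dropm takem eqseq_cons; have [cz | ncz] := boolP (c z).
    by rewrite /= eqseq_rcons; do !case: (_ == _).
  by case: eqP => //= zx; rewrite zx cx in ncz.
have -> : 1 - (size l)%:R / m.+1%:R = (size r)%:R / m.+1%:R :> R.
  by apply/eqP; rewrite subr_eq -mulrDl -natrD addnC sz_lr divff.
case/lastP: r cr sz_lr {rhs} => [_ _ | r x].
  rewrite mul0r mul0r mulr0; case: (c z) => //=.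
  by rewrite -[_ == [::]]size_eq0 size_rcons /= !andbF.
rewrite all_rcons => /andP[cx cr]; rewrite size_rcons addnS => -[sz_lr].
rewrite /above_bottom /bottom_card size_rcons /= -cats1.
rewrite take_size_cat // drop_size_cat // cats1.
have -> : 'C(m.+1, size l)%:R * ((size r).+1%:R / m.+1%:R *
    drop_pr R m l r (x :: s) w) =
    'C(m, size l)%:R * drop_pr R m l r (x :: s) w.
  rewrite !mulrA -natrM mulnC.
  have -> : (size r).+1 = (m.+1 - size l)%N by rewrite -sz_lr -addnS addKn.
  rewrite -mul_bin_down natrM.
  by rewrite [_ * 'C(_, _)%:R]mulrC mulfK.
rewrite IHm //; last by rewrite sz_w addSnnS.
rewrite dropm takem eqseq_cons; have [cz | ncz] := boolP (c z).
  by case: eqP => //= zx; rewrite /= -zx cz in cx.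
by rewrite /= eqseq_rcons; do !case: (_ == _).
Qed.

(** The letter false marks the left pile, so that false < true puts its cards,
    the smaller ones, first. *)
Definition coin (theta : R) (b : bool) : R := if b then 1 - theta else theta.

(** The only word with N letters false that can standardize to w: see
    [pile_word_std]. *)
Definition pile_word n N (w : 'S_n) : {ffun 'I_n -> bool} :=
  [ffun i => ~~ (w i < N)%N].

Lemma card_pile_word n N (w : 'S_n) :
  (N <= n)%N -> #|[set i | ~~ pile_word N w i]| = N.
Proof.
move=> le_Nn; rewrite -(card_imset _ (@perm_inj _ w)).
have ->: w @: [set i | ~~ pile_word N w i] = [set j : 'I_n | (j < N)%N].
  apply/setP=> j; rewrite inE; apply/imsetP/idP => [[k] | lt_j].
    by rewrite inE ffunE negbK => lt_k ->.
  by exists (w^-1%g j); rewrite ?inE ?ffunE permKV ?negbK.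
rewrite -sum1dep_card (big_ord_narrow le_Nn).
by rewrite sum1_card card_ord.
Qed.

Lemma weight_coin n theta (f : {ffun 'I_n -> bool}) (N := #|[set i | ~~ f i]|) :
  weight (coin theta) f = theta ^+ N * (1 - theta) ^+ (n - N).
Proof.
rewrite /weight (bigID (fun i => ~~ f i)) /=.
rewrite (eq_bigr (fun=> theta)) => [|i /negPf fi]; last by rewrite /coin fi.
rewrite prodr_const [X in _ * X](eq_bigr (fun=> 1 - theta)); last first.
  by move=> i; rewrite negbK /coin => ->.
rewrite prodr_const; congr (_ ^+ _ * _ ^+ _); first by rewrite /N cardsE.
transitivity #|~: [set i | ~~ f i]|; first by apply: eq_card => i; rewrite !inE.
by rewrite -(addKn N #|~: _|) cardsC card_ord.
Qed.

(** The letters false get the smallest ranks, so f is recovered from its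
    standardization and their number. *)
Lemma pile_word_std n (f : {ffun 'I_n -> bool}) :
  f = pile_word #|[set i | ~~ f i]| (std f).
Proof.
apply/ffunP=> i; rewrite ffunE permE /= /rank -leqNgt.
case fi: (f i); symmetry.
  apply/subset_leq_card/subsetP=> j; rewrite !inE /before fi.
  by case: (f j).
apply/negbTE; rewrite -ltnNge; apply/proper_card; rewrite properE.
apply/andP; split.
  by apply/subsetP=> j; rewrite !inE /before fi; case: (f j).
by apply/subsetPn; exists i; rewrite !inE ?fi // before_irr.
Qed.

Lemma sorted_enum_ord n : sorted (relpre val ltn) (enum 'I_n).
Proof. by rewrite -sorted_map val_enum_ord iota_ltn_sorted. Qed.

Lemma filter_deckP n (w : 'S_n) (c : pred 'I_n) :
  reflect (forall i j, c (w i) -> c (w j) -> (i < j)%N -> (w i < w j)%N)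
          (filter c (deck w) == filter c (enum 'I_n)).
Proof.
have tr (h : 'I_n -> nat) : transitive (relpre h ltn).
  by move=> j i k /=; apply: ltn_trans.
rewrite /deck filter_map; set s := filter _ _.
have mem_s i : (i \in s) = c (w i) by rewrite mem_filter mem_enum andbT.
have sorted_s : sorted (relpre val ltn) s.
  by apply: sorted_filter (sorted_enum_ord n).
apply: (iffP eqP) => [eq_s i j ci cj lt_ij | w_mono].
  have: sorted (relpre val ltn) (map w s).
    by rewrite eq_s; apply: sorted_filter (sorted_enum_ord n).
  rewrite sorted_map => /(sorted_ltn_index (tr (val \o w))) ws_mono.
  have [si sj] : i \in s /\ j \in s by rewrite !mem_s.
  apply: ws_mono; rewrite // ltnNge; apply: contraL lt_ij.
  rewrite leq_eqVlt -leqNgt => /orP[/eqP eq_ij | lt_ji].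
    by rewrite (index_inj i sj si eq_ij).
  exact/ltnW/(sorted_ltn_index (tr val) sorted_s).
apply: (@irr_sorted_eq _ (relpre val ltn)) => [|i|||i].
- exact: tr.
- exact: ltnn.
- rewrite sorted_map; apply: (@sub_in_sorted _ [pred i | c (w i)]) sorted_s.
    by move=> i j ci cj; apply: w_mono.
  by apply/allP=> i; rewrite mem_s.
- exact: sorted_filter (sorted_enum_ord n).
rewrite mem_filter mem_enum andbT; apply/mapP/idP => [[j] | ci].
  by rewrite mem_s => cj ->.
by exists (w^-1%g i); rewrite ?mem_s permKV.
Qed.

Lemma all_take_enum n N : all (fun x : 'I_n => (x < N)%N) (take N (enum 'I_n)).
Proof.
rewrite -(all_map val (fun x => (x < N)%N)) map_take val_enum_ord take_iota.
by apply/allP=> x; rewrite mem_iota => /= /leq_trans; apply; apply: geq_minl.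
Qed.

Lemma all_drop_enum n N :
  all (predC (fun x : 'I_n => (x < N)%N)) (drop N (enum 'I_n)).
Proof.
rewrite -(all_map val (predC (fun x => (x < N)%N))) map_drop.
rewrite val_enum_ord drop_iota.
by apply/allP=> x; rewrite mem_iota /= -leqNgt => /andP[].
Qed.

Lemma filter_enum_lt n N :
  filter (fun x : 'I_n => (x < N)%N) (enum 'I_n) = take N (enum 'I_n).
Proof.
rewrite -[in LHS](cat_take_drop N (enum 'I_n)) filter_cat.
rewrite (all_filterP (all_take_enum n N)).
rewrite (eq_in_filter (a2 := pred0)) ?filter_pred0 ?cats0 // => x.
by move/(allP (all_drop_enum n N))/negPf.
Qed.

Lemma filter_enum_ge n N :
  filter (predC (fun x : 'I_n => (x < N)%N)) (enum 'I_n) = drop N (enum 'I_n).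
Proof.
rewrite -[in LHS](cat_take_drop N (enum 'I_n)) filter_cat.
rewrite (all_filterP (all_drop_enum n N)).
rewrite (eq_in_filter (a2 := pred0)) ?filter_pred0 // => x.
by move/(allP (all_take_enum n N)) => /= ->.
Qed.

(** After a cut at N, both conditions say that w increases along the positions
    of each pile. *)
Lemma std_pile_wordE n N (w : 'S_n) (c := fun x : 'I_n => (x < N)%N) :
  (filter c (deck w) == take N (enum 'I_n)) &&
  (filter (predC c) (deck w) == drop N (enum 'I_n)) =
  (std (pile_word N w) == w).
Proof.
rewrite -filter_enum_lt -filter_enum_ge.
apply/andP/eqP=> [[/filter_deckP lt_mono /filter_deckP ge_mono] | def_w].
  have mono i j : (w i < N)%N = (w j < N)%N -> (i < j)%N -> (w i < w j)%N.
    case cj: (w j < N)%N => ci; first exact: lt_mono.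
    by apply: ge_mono; rewrite /= /c ?ci ?cj.
  apply: std_unique => i j; rewrite /before !ffunE.
  case ci: (w i < N)%N; case cj: (w j < N)%N => /=.
  - apply/idP/idP; last by apply: mono; rewrite ci cj.
    apply: contraTT; rewrite -!leqNgt leq_eqVlt => /orP[/eqP/val_inj-> //|].
    by move=> lt_ji; rewrite ltnW // mono // ci cj.
  - by rewrite (leq_trans ci) // leqNgt cj.
  - by apply/negbTE; rewrite -leqNgt ltnW // (leq_trans cj) // leqNgt ci.
  apply/idP/idP; last by apply: mono; rewrite ci cj.
  apply: contraTT; rewrite -!leqNgt leq_eqVlt => /orP[/eqP/val_inj-> //|].
  by move=> lt_ji; rewrite ltnW // mono // ci cj.
have mono i j : (w i < N)%N = (w j < N)%N -> (i < j)%N -> (w i < w j)%N.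
  by move=> c_ij lt_ij; rewrite -def_w stdE /before !ffunE c_ij ltxx eqxx.
split; apply/filter_deckP => i j ci cj; apply: mono.
  by move: ci cj; rewrite /c => -> ->.
by move: ci cj; rewrite /= /c => /negPf-> /negPf->.
Qed.

(** The sums over the cut N and over the words match through
    N |-> pile_word N w: the binomial coefficient of the cut cancels the
    uniform probability of an interleaving. *)
Lemma riffle_word_law n theta (w : 'S_n) :
  riffle theta w = word_law (coin theta) w.
Proof.
have size_deck : size (deck w) = n by rewrite size_map size_enum_ord.
have drop_deck : drop n (deck w) = [::] by rewrite drop_oversize ?size_deck.
have take_deck : take n (deck w) = deck w by rewrite take_oversize ?size_deck.
transitivity (\sum_(N < n.+1 | std (pile_word N w) == w)
                theta ^+ N * (1 - theta) ^+ (n - N)).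
  rewrite [RHS]big_mkcond; apply: eq_bigr => N _.
  have le_Nn : (N <= n)%N by rewrite -ltnS.
  rewrite -!mulrA mulrCA [X in _ * X]mulrCA !mulrA -[LHS]mulrA.
  have := @drop_prE _ (fun x : 'I_n => (x < N)%N) n (take N (enum 'I_n))
    (drop N (enum 'I_n)) [::] (deck w) (all_take_enum n N) (all_drop_enum n N).
  rewrite -size_cat cat_take_drop size_enum_ord size_deck addn0.
  rewrite size_takel ?size_enum_ord // => -> //.
  rewrite drop_deck take_deck eqxx andTb std_pile_wordE.
  by case: (_ == _); rewrite ?mulr1 ?mulr0.
pose left_size (f : {ffun 'I_n -> bool}) : 'I_n.+1 := inord #|[set i | ~~ f i]|.
have left_sizeE f : left_size f = #|[set i | ~~ f i]| :> nat.
  by rewrite inordK // ltnS -[n in leqRHS]card_ord max_card.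
rewrite /word_law.
rewrite (reindex_onto (fun N : 'I_n.+1 => pile_word N w) left_size) /=.
  apply: eq_big => N.
    rewrite -(inj_eq (@ord_inj _)) left_sizeE card_pile_word ?eqxx ?andbT //.
    by rewrite -ltnS.
  by move=> _; rewrite weight_coin card_pile_word // -ltnS.
by move=> f /eqP <-; rewrite left_sizeE -pile_word_std.
Qed.

End Riffle.

(** * The distances to uniform *)

Lemma max_permE (R : realFieldType) (n : nat) (F : 'S_n -> R) (u : 'S_n) :
  (forall w, F w <= F u) -> max_perm F = F u.
Proof.
move=> F_le; apply/le_anti/andP; split; first by apply: bigmax_le.
exact: le_bigmax.
Qed.

(** The sum is that of (1 + sgn w) times the cycle weight of w, to which the
    identity contributes 2. *)
Lemma nondecr_incr_sum_ge2 (R : realFieldType) d (A : finOrderType d) (n : nat)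
    (q : A -> R) :
  (forall a, 0 <= q a) -> power_sum q 1 = 1 ->
  2 <= n`!%:R * nondecr_sum n q + n`!%:R * incr_sum n q.
Proof.
move=> q_ge0 psum1; rewrite fact_nondecr_sum fact_incr_sum -big_split /=.
have cw_ge0 w : 0 <= cycle_weight q w.
  by rewrite -sum_fixed; apply: sumr_ge0 => f _; apply: weight_ge0.
rewrite (bigD1 1%g) //= {1 2}/sgn odd_perm1 expr0 mul1r.
have -> : cycle_weight q (1%g : 'S_n) = 1.
  rewrite -sum_fixed (eq_bigl predT) => [|f]; last by rewrite wcomp1 eqxx.
  by rewrite /weight -(bigA_distr_bigA (fun=> q)) big1.
rewrite lerDl; apply: sumr_ge0 => w _.
rewrite /sgn; case: odd_perm; rewrite ?expr0 ?expr1 ?mulN1r ?subrr //.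
by rewrite mul1r addr_ge0.
Qed.

Theorem mainTheorem2 (R : realFieldType) (n k : nat) (theta : R)
    (hn : (1 <= n)%N) (htheta : 0 <= theta <= 1) :
  SEP n theta k =
    1 - \sum_(w : 'S_n) sgn R w *
          \prod_(1 <= i < n.+1)
            (theta ^+ i + (1 - theta) ^+ i) ^+ (k * ncycles i w)
  /\
  linf n theta k =
    \sum_(w : 'S_n)
      \prod_(1 <= i < n.+1)
        (theta ^+ i + (1 - theta) ^+ i) ^+ (k * ncycles i w)
    - 1.
Proof.
have [theta_ge0 theta_le1] := andP htheta.
have coin_ge0 b : 0 <= coin theta b by case: b; rewrite //= subr_ge0.
have coin_psum m : power_sum (coin theta) m = theta ^+ m + (1 - theta) ^+ m.
  by rewrite /power_sum big_bool addrC.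
have [d [A [q [q_ge0 q_psum q_law]]]] :=
  conv_pow_word_law (P := riffle theta) k coin_ge0 (@riffle_word_law R n theta).
have cwE (w : 'S_n) : \prod_(1 <= i < n.+1)
    (theta ^+ i + (1 - theta) ^+ i) ^+ (k * ncycles i w) = cycle_weight q w.
  by apply: eq_bigr => m _; rewrite q_psum coin_psum exprM.
under eq_bigr => w _ do rewrite cwE.
under [X in _ /\ _ = X - 1]eq_bigr => w _ do rewrite cwE.
rewrite -fact_incr_sum -fact_nondecr_sum.
have nfact_gt0 : 0 < n`!%:R :> R by rewrite ltr0n fact_gt0.
have lawE (w : 'S_n) : conv_pow (riffle theta) k w / unif R w =
    n`!%:R * word_law q w.
  by rewrite q_law /unif div1r invrK mulrC.
have law_le (w : 'S_n) : n`!%:R * word_law q w <= n`!%:R * nondecr_sum n q.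
  by rewrite ler_pM2l // word_law_le.
have law_ge (w : 'S_n) : n`!%:R * incr_sum n q <= n`!%:R * word_law q w.
  by rewrite ler_pM2l // word_law_ge.
have sum_ge2 := nondecr_incr_sum_ge2 n q_ge0.
rewrite q_psum coin_psum !expr1 addrC subrK expr1n in sum_ge2.
have {}sum_ge2 := sum_ge2 erefl.
split.
  rewrite /SEP (max_permE (u := rev_perm n)) => [|w].
    by rewrite lawE word_law_rev.
  by rewrite !lawE word_law_rev lerD2l lerN2.
have H_ge1 : 1 <= n`!%:R * nondecr_sum n q.
  rewrite -(ler_pM2l (ltr0n R 2)) mulr1 mulr2n mulrDl !mul1r.
  apply: le_trans sum_ge2 _; rewrite lerD2l.
  by apply: le_trans (law_ge 1%g) (law_le 1%g).
have H_norm : `|1 - n`!%:R * nondecr_sum n q| = n`!%:R * nondecr_sum n q - 1.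
  by rewrite distrC ger0_norm // subr_ge0.
rewrite /linf (max_permE (u := 1%g)) => [|w].
  by rewrite lawE word_law1.
rewrite !lawE word_law1 H_norm ler_norml opprB lerD2l lerN2 law_le /=.
(* What remains is 1 - n! P(w) <= n! H - 1, that is, 2 <= n! H + n! P(w). *)
rewrite lerBlDr addrAC lerBrDr -[1 + 1]/(2%:R : R).
by apply: le_trans sum_ge2 _; rewrite lerD2l.
Qed.
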